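(* Let $G$ be a domain in $\mathbb{C}^n$ and let $E$ be a pluripolar subset of $G$. Assume $u$ is a plurisubharmonic function on $G$ such that $Z=\{z\in G:u(z)=-\infty\}\supset E$ and $u$ is locally bounded on $G\setminus Z$. Then for every domain $D\Subset G$ and every open set $U\supset Z$, $$\omega(z,E\cap D,D)=\omega(z,E\cap D,U\cap D),\qquad z\in U\cap D.$$
   Context: For an open set $\Omega\subset\mathbb{C}^n$ and $E\subset\Omega$, the relative extremal function (pluriharmonic measure) is $\omega(z,E,\Omega)=-\sup\{v(z): v \text{ plurisubharmonic on }\Omega,\ v\le-1\text{ on }E,\ v\le0\text{ on }\Omega\}$, $z\in\Omega$ (for disconnected $\Omega$ this is computed on each connected component separately). *)

(* Defs.v *)
From HB Require Import structures.
From mathcomp Require Import all_boot all_order all_algebra.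
From mathcomp Require Import all_classical all_reals all_analysis.
Set Implicit Arguments. Unset Strict Implicit. Unset Printing Implicit Defensive.
Import Order.TTheory GRing.Theory Num.Theory.
Import numFieldNormedType.Exports.
Local Open Scope classical_set_scope.
Local Open Scope ring_scope.

(* C^n is modelled as R^n x R^n : a point z is the pair (Re z, Im z) of
   real row vectors; it carries the library's product (normed) topology. *)
Notation Cn R n := ('rV[R]_n * 'rV[R]_n)%type.

(* the point a + (x + i y) b of the complex line through a with direction b *)
Definition cline (R : realType) (n : nat) (a b : Cn R n) (x y : R) : Cn R n :=
  (a.1 + x *: b.1 - y *: b.2, a.2 + x *: b.2 + y *: b.1).

Definition usc_on (R : realType) (n : nat) (Om : set (Cn R n))
    (u : Cn R n -> \bar R) :=
  forall z, Om z -> forall c : R, (u z < c%:E)%E -> \forall w \near z, (u w < c%:E)%E.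

Definition psh (R : realType) (n : nat) (Om : set (Cn R n)) (u : Cn R n -> \bar R) :=
  [/\ forall z, Om z -> (u z < +oo)%E,
      usc_on Om u &
      forall a b : Cn R n,
        (forall x y : R, x ^+ 2 + y ^+ 2 <= 1 -> Om (cline a b x y)) ->
        (u a <= ((2 * pi)^-1)%:E *
           \int[@lebesgue_measure R]_(t in `[0%R, (2 * pi)%R]) u (cline a b (cos t) (sin t)))%E].

Definition rel_extremal (R : realType) (n : nat) (E Om : set (Cn R n)) (z : Cn R n)
  : \bar R :=
  (- ereal_sup [set v z | v in [set v : Cn R n -> \bar R |
      [/\ psh Om v, (forall w, E w -> v w <= -1%:E)%E &
          (forall w, Om w -> v w <= 0)%E]]])%E.

Definition pluripolar (R : realType) (n : nat) (E : set (Cn R n)) :=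
  forall a, E a -> exists V : set (Cn R n),
    [/\ open V, connected V, V a &
      exists v, [/\ psh V v, (exists w, V w /\ v w != -oo%E) &
                    forall w, E w -> V w -> v w = -oo%E]].

Definition locally_bounded_on (R : realType) (n : nat) (S : set (Cn R n))
    (u : Cn R n -> \bar R) :=
  forall z, S z -> exists M : R, \forall w \near z, S w -> (`|u w| <= M%:E)%E.

Definition relcompact_in (R : realType) (n : nat) (D G : set (Cn R n)) :=
  compact (closure D) /\ closure D `<=` G.

Definition domain (R : realType) (n : nat) (G : set (Cn R n)) :=
  open G /\ connected G.

(* Main.v *)
Require Import Defs.
From HB Require Import structures.
From mathcomp Require Import all_boot all_order all_algebra.
From mathcomp Require Import all_classical all_reals all_analysis.
From mathcomp Require Import measurable_realfun.
From mathcomp Require Import ring lra.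
Import Order.TTheory GRing.Theory Num.Theory.
Import numFieldNormedType.Exports.
Local Open Scope classical_set_scope.
Local Open Scope ring_scope.
Set Implicit Arguments.
Unset Strict Implicit.
Unset Printing Implicit Defensive.

(* Let [v] compete for the extremal function of [U `&` D].  The set of poles of
   [u] is closed in [G], so [u >= - M] on a neighbourhood of [closure D `\` U].
   For [e > 0] put [p := e (u + M)]: it is [>= 0 >= v] near [D `\` U] and [-oo]
   on [E].  Hence [max v p] on [U `&` D], continued by [p], is plurisubharmonic
   on [D], equals [v] on [E], and exceeds [0] by at most [e (C + M)], where [C]
   bounds [u] on [closure D].  Subtracting this constant and letting [e] tend to
   [0] gives the nontrivial inequality.

   Plurisubharmonicity is required on every closed disc, so the gluing step
   needs that it is a local property.  On a disc, with [F := C - u >= 0], the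
   radial mean of [F] is lower semicontinuous (Fatou) and satisfies a minimum
   principle, which compares the center with the boundary circle. *)

(* Splitting [C - f = (C - f^+) + f^-] into nonnegative parts keeps the
   identity valid when [f] is not integrable. *)
Lemma integral_cstB d (T : measurableType d) (R : realType)
    (mu : {measure set T -> \bar R}) (D : set T) (f : T -> \bar R) (C : R) :
  measurable D -> (mu D < +oo)%E -> measurable_fun D f -> 0 <= C ->
  (forall x, D x -> f x <= C%:E)%E ->
  (\int[mu]_(x in D) (C%:E - f x) = C%:E * mu D - \int[mu]_(x in D) f x)%E.
Proof.
move=> mD muD mf C0 fC.
have fpC x : D x -> (f^\+ x <= C%:E)%E.
  by move=> Dx; rewrite funeposE ge_max fC//= lee_fin.
have mfp := measurable_funepos mf; have mfn := measurable_funeneg mf.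
have mCf : measurable_fun D (fun x => C%:E - f^\+ x)%E.
  by apply: emeasurable_funB => //; exact: measurable_cst.
have CfD x : D x -> (0 <= C%:E - f^\+ x)%E.
  by move=> Dx; rewrite subre_ge0 ?fpC.
have E1 : (\int[mu]_(x in D) (C%:E - f x) =
    \int[mu]_(x in D) (C%:E - f^\+ x) + \int[mu]_(x in D) f^\- x)%E.
  rewrite -ge0_integralD//; apply: eq_integral => x /set_mem Dx.
  move: (fC _ Dx); rewrite funeposE funenegE; case: (f x) => [r| |]//= _.
    rewrite -!EFin_max -!EFinN -!EFinD; congr (_%:E).
    by rewrite /Order.max; case: ifPn; case: ifPn; lra.
  by rewrite maxye maxNye oppe0 adde0.
have E2 : (\int[mu]_(x in D) (C%:E - f^\+ x) + \int[mu]_(x in D) f^\+ x =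
   C%:E * mu D)%E.
  rewrite -ge0_integralD//.
  rewrite -[RHS](integral_cst mu mD C%:E); apply: eq_integral => x /set_mem Dx.
  by rewrite subeK// ge0_fin_numE// (le_lt_trans (fpC _ Dx))// ltry.
have Cfin : (C%:E * mu D < +oo)%E.
  by rewrite -ge0_fin_numE ?mule_ge0// fin_numM// ge0_fin_numE.
(* The positive part is at most [C] on a set of finite measure, so its integral is finite and can be
   cancelled; the negative part may integrate to [+oo]. *)
have pfin : (\int[mu]_(x in D) f^\+ x)%E \is a fin_num.
  rewrite ge0_fin_numE ?integral_ge0// (le_lt_trans _ Cfin)// -E2.
  by rewrite leeDr// integral_ge0.
by rewrite E1 [in RHS]integralE -E2 oppeB ?fin_num_adde_defr// [in RHS]addeA addeK.
Qed.

(** * Semicontinuity: measurability and bounds on compact sets *)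

Section lsc.
Variable R : realType.

(** An open subset of the plane is the union of the countably many squares inside it with rational
    centres and radii [1 / (k + 1)], and these are measurable rectangles. *)
Lemma open_measurable_prod (A : set (R * R)) : open A -> measurable A.
Proof.
move=> oA.
pose B (q : rat * rat * nat) : set (R * R) :=
  ball (ratr q.1.1 : R) (q.2.+1%:R^-1) `*` ball (ratr q.1.2 : R) (q.2.+1%:R^-1).
have -> : A = \bigcup_q (if `[< B q `<=` A >] then B q else set0).
  apply/seteqP; split=> [[x y] Axy|p [q _]]; last first.
    by case: asboolP => // BA Bp; exact: BA.
  have /nbhs_ballP[e /= e0 eA] : nbhs (x, y) A by exact: open_nbhs_nbhs.
  (* With [r < e / 2], a square of radius [r] centred within [r] of [(x, y)] stays in the
     [e]-ball. *)
  have [k [r [rE re r0]]] : exists k (r : R), [/\ r = k.+1%:R^-1, r < e / 2 & 0 < r].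
    exists (Num.truncn (e / 2)^-1); eexists; split; [by []| |by rewrite invr_gt0].
    rewrite invf_plt ?posrE ?divr_gt0//; exact: truncnS_gt.
  have [|p1] := @rat_in_itvoo R (x - r) (x + r); first lra.
  rewrite in_itv/= => h1.
  have [|p2] := @rat_in_itvoo R (y - r) (y + r); first lra.
  rewrite in_itv/= => h2.
  exists (p1, p2, k) => //; case: asboolP => [_|].
    by rewrite /B /= -rE !/ball/= !ltr_norml; split; lra.
  case => -[a b]; rewrite /B /= -rE !/ball/= !ltr_norml => -[h3 h4].
  by apply: eA; split; rewrite /= /ball/= ltr_norml; lra.
apply: countable_bigcupT_measurable => // q; case: ifP => // _.
by apply: measurableX; exact: measurable_ball.
Qed.

Lemma lsc_measurable_prod (f : R * R -> \bar R) :
  lower_semicontinuous f -> measurable_fun setT f.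
Proof.
move=> scif; apply: (measurability _ (ErealGenOInfty.measurableE R)).
move=> /= _ [_ [a ->]] <-; apply: measurableI => //.
apply: open_measurable_prod.
by rewrite preimage_itvoy; move/lower_semicontinuousP : scif; exact.
Qed.

Lemma lsc_comp (X Y : topologicalType) (g : X -> Y) (f : Y -> \bar R) :
  continuous g -> lower_semicontinuous f -> lower_semicontinuous (f \o g).
Proof.
move=> cg lf x a /lf[V Vgx Va]; exists (g @^-1` V); first exact: cg.
by move=> y /Va.
Qed.

Lemma lte_EFinB (a C : R) (w : \bar R) :
  (a%:E < C%:E - w)%E = (w < (C - a)%:E)%E.
Proof.
case: w => [r| |] //=; rewrite ?ltry ?ltNyr//.
by rewrite -EFinD !lte_fin; apply/idP/idP; lra.
Qed.

Lemma usc_comp_lsc n (Om : set (Cn R n)) u C (X : topologicalType)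
    (g : X -> Cn R n) : usc_on Om u -> continuous g -> (forall x, Om (g x)) ->
  lower_semicontinuous (fun x => C%:E - u (g x))%E.
Proof.
move=> us cg Og x a; rewrite lte_EFinB => /(us _ (Og x)) h.
exists (g @^-1` [set w | u w < (C - a)%:E]%E); first exact: cg.
by move=> y /=; rewrite lte_EFinB.
Qed.

Lemma usc_comp_measurable n (Om : set (Cn R n)) u (g : R -> Cn R n) :
  usc_on Om u -> continuous g -> (forall x, Om (g x)) ->
  measurable_fun setT (u \o g).
Proof.
move=> us cg Og; have := lower_semicontinuous_measurable
  (@usc_comp_lsc n Om u 0 _ g us cg Og) => h.
have -> : u \o g = (fun x => - (0 - u (g x)))%E.
  by apply/funext => x /=; rewrite sub0e oppeK.
exact/measurableT_comp.
Qed.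

(** Semicontinuity gives an upper bound near each point, and compactness makes it uniform. The sign
    of [C] is recorded because [integral_cstB] asks for it. *)
Lemma usc_bounded n (Om : set (Cn R n)) u (K : set (Cn R n)) :
  usc_on Om u -> (forall z, Om z -> u z < +oo)%E -> compact K -> K `<=` Om ->
  exists2 C : R, 0 <= C & forall z, K z -> (u z <= C%:E)%E.
Proof.
move=> us uy /compact_near_coveringP cK KO.
suff [C [C0 HC]] : exists C : R, 0 <= C /\ K `<=` (fun z => u z <= C%:E)%E.
  by exists C.
suff : \forall C \near +oo, 0 <= C /\ K `<=` (fun z => u z <= C%:E)%E.
  exact: filter_ex.
near=> C; split; first by near: C; exact: nbhs_pinfty_ge.
near: C; apply: cK => z Kz.
have [c uc] : exists c : R, (u z < c%:E)%E.
  case: (u z) (uy z (KO _ Kz)) => [r _|//|_]; last by exists 0; rewrite ltNyr.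
  by exists (r + 1); rewrite lte_fin; lra.
exists ([set w | u w < c%:E]%E, [set C | c <= C]).
  by split; [exact: us (KO _ Kz) c uc|apply: nbhs_pinfty_ge; exact: num_real].
by case=> w C /= [/ltW h1 h2]; rewrite (le_trans h1)// lee_fin.
Unshelve. all: end_near. Qed.

End lsc.

(** * The mean value inequality over the circle *)

Section circle.
Variable R : realType.
Local Notation mu := (@lebesgue_measure R).
Local Notation I2pi := (`[0%R, (2 * pi)%R]%classic : set R).

Lemma twopi_gt0 : 0 < 2 * pi :> R.
Proof. by rewrite mulr_gt0// pi_gt0. Qed.

Lemma lebesgue_I2pi : mu I2pi = (2 * pi)%:E.
Proof. by rewrite lebesgue_measure_itv/= lte_fin twopi_gt0 oppr0 addr0. Qed.

(** Multiplying by [2 * pi] and subtracting from [C] turns the sub-mean inequality into a bound on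
    the integral of a nonnegative function. The form as an equality allows rewriting in both
    directions; infinite values are treated case by case. *)
Lemma le_mean (f : R -> \bar R) (x : \bar R) (C : R) :
  measurable_fun setT f -> 0 <= C -> (forall t, f t <= C%:E)%E -> (x <= C%:E)%E ->
  (x <= ((2 * pi)^-1)%:E * \int[mu]_(t in I2pi) f t)%E =
  (\int[mu]_(t in I2pi) (C%:E - f t) <= (2 * pi)%:E * (C%:E - x))%E.
Proof.
move=> mf C0 fC xC; have p0 := twopi_gt0.
have E : (\int[mu]_(t in I2pi) (C%:E - f t) =
    C%:E * (2 * pi)%:E - \int[mu]_(x in I2pi) f x)%E.
  rewrite integral_cstB//; last exact: measurable_funTS.
    by congr (_ * _ - _)%E; exact: lebesgue_I2pi.
  by rewrite [ltLHS]lebesgue_I2pi ltry.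
have : (0 <= \int[mu]_(t in I2pi) (C%:E - f t))%E.
  by apply: integral_ge0 => t _; rewrite subre_ge0 ?fC.
rewrite E; set I := (\int[mu]_(x in I2pi) f x)%E.
case: I => [r| |]//=.
  move=> _; case: x xC => [x| |]//= _; last first.
    by rewrite leNye mulry gtr0_sg// mul1e leey.
  rewrite -!EFinD -!EFinM !lee_fin.
  rewrite [_^-1 * _]mulrC ler_pdivlMr//; apply/idP/idP; lra.
move=> _; rewrite mulrNy gtr0_sg ?invr_gt0// mul1e.
case: x xC => [x| |]//= _; last by rewrite lexx mulry gtr0_sg// mul1e leey.
Qed.

End circle.

Lemma continuous_pair (X Y Z : topologicalType) (f : X -> Y) (g : X -> Z) :
  continuous f -> continuous g -> continuous (fun x => (f x, g x)).
Proof.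
by move=> cf cg x; apply: (@cvg_pair _ _ _ (nbhs x) (nbhs (f x)) (nbhs (g x)));
  [exact: cf|exact: cg].
Qed.

(** * Closed discs in complex lines *)

Section cline.
Variables (R : realType) (n : nat).
Implicit Types (a b : Cn R n).

Lemma cline_continuous a b : continuous (fun p : R * R => cline a b p.1 p.2).
Proof.
rewrite /cline; apply: continuous_pair => p /=.
  apply: cvgB; first apply: cvgD; first exact: cvg_cst.
    by apply: cvgZr_tmp; exact: cvg_fst.
  by apply: cvgZr_tmp; exact: cvg_snd.
apply: cvgD; first apply: cvgD; first exact: cvg_cst.
  by apply: cvgZr_tmp; exact: cvg_fst.
by apply: cvgZr_tmp; exact: cvg_snd.
Qed.

Lemma circ_continuous a b : continuous (fun t : R => cline a b (cos t) (sin t)).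
Proof.
move=> t; apply: (@continuous_comp _ _ _ (fun t : R => (cos t, sin t))
  (fun p : R * R => cline a b p.1 p.2)); last exact: cline_continuous.
by apply: continuous_pair; [exact: continuous_cos|exact: continuous_sin].
Qed.

Definition cdisc a b : set (Cn R n) :=
  [set cline a b p.1 p.2 | p in [set p : R * R | p.1 ^+ 2 + p.2 ^+ 2 <= 1]].

Lemma compact_unit_disc : compact [set p : R * R | p.1 ^+ 2 + p.2 ^+ 2 <= 1].
Proof.
apply: (@subclosed_compact _ _ (`[(-1 : R), 1]%classic `*` `[(-1 : R), 1]%classic)).
- have -> : [set p : R * R | p.1 ^+ 2 + p.2 ^+ 2 <= 1] =
    (fun p => p.1 ^+ 2 + p.2 ^+ 2) @^-1` [set x | x <= 1] by [].
  apply: closed_comp; last exact: closed_le.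
  move=> p _; apply: cvgD; rewrite /= !expr2; apply: cvgM;
    by [exact: cvg_fst|exact: cvg_snd].
- by apply: compact_setX; exact: segment_compact.
- by move=> -[x y]/= h; split; rewrite /= in_itv/=; nra.
Qed.

Lemma compact_cdisc a b : compact (cdisc a b).
Proof.
apply: continuous_compact; last exact: compact_unit_disc.
by apply: continuous_subspaceT; exact: cline_continuous.
Qed.

Lemma cdisc_circ a b t : cdisc a b (cline a b (cos t) (sin t)).
Proof. by exists (cos t, sin t) => //=; rewrite cos2Dsin2. Qed.

Lemma cline0 a b : cline a b 0 0 = a.
Proof. by rewrite /cline !scale0r !addr0 subr0; case: a. Qed.

Lemma cdisc_center a b : cdisc a b a.
Proof. by exists (0, 0) => /=; [rewrite expr0n/= addr0|rewrite cline0]. Qed.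

End cline.

(** * Elementary stability properties of plurisubharmonic functions *)

Section psh_basics.
Variables (R : realType) (n : nat).
Implicit Types (Om : set (Cn R n)) (u v : Cn R n -> \bar R).
Local Notation mu := (@lebesgue_measure R).
Local Notation I2pi := (`[0%R, (2 * pi)%R]%classic : set R).

(** In all uses [C] bounds [u] from above on the disc, so the integrand is nonnegative. There is no
    division by [2 * pi]. *)
Definition circle_integral (C : R) u (a b : Cn R n) : \bar R :=
  (\int[mu]_(t in I2pi) (C%:E - u (cline a b (cos t) (sin t))))%E.

Lemma usc_circ_measurable Om u a b : usc_on Om u -> cdisc a b `<=` Om ->
  measurable_fun setT (fun t => u (cline a b (cos t) (sin t))).
Proof.
move=> us dO; apply: (@usc_comp_measurable _ _ Om u _ us).
  exact: circ_continuous.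
by move=> t; apply/dO/cdisc_circ.
Qed.

Lemma usc_circ_measurableB Om u a b (C : R) : usc_on Om u -> cdisc a b `<=` Om ->
  measurable_fun setT (fun t => C%:E - u (cline a b (cos t) (sin t)))%E.
Proof.
move=> us dO; apply: emeasurable_funB; first exact: measurable_cst.
exact: usc_circ_measurable us dO.
Qed.

Lemma submeanE Om u a b (C : R) : usc_on Om u -> cdisc a b `<=` Om ->
  0 <= C -> (forall z, cdisc a b z -> (u z <= C%:E)%E) ->
  (u a <= ((2 * pi)^-1)%:E * \int[mu]_(t in I2pi) u (cline a b (cos t) (sin t)))%E
  = (circle_integral C u a b <= (2 * pi)%:E * (C%:E - u a))%E.
Proof.
move=> us dO C0 uC; apply: le_mean => //.
- exact: usc_circ_measurable us dO.
- by move=> t; apply/uC/cdisc_circ.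
- exact/uC/cdisc_center.
Qed.

Lemma usc_disc_bounded Om u a b : usc_on Om u -> (forall z, Om z -> (u z < +oo)%E) ->
  cdisc a b `<=` Om ->
  exists2 C : R, 0 <= C & forall z, cdisc a b z -> (u z <= C%:E)%E.
Proof. by move=> us uy; apply: usc_bounded us uy _; exact: compact_cdisc. Qed.

Lemma psh_submean Om u a b (C : R) : psh Om u -> cdisc a b `<=` Om ->
  0 <= C -> (forall z, cdisc a b z -> (u z <= C%:E)%E) ->
  (circle_integral C u a b <= (2 * pi)%:E * (C%:E - u a))%E.
Proof.
move=> -[_ us um] dO C0 uC; rewrite -(submeanE us dO C0 uC); apply: um.
by move=> x y xy; apply: dO; exists (x, y).
Qed.

(** By [submeanE] the sub-mean inequality can be tested on each disc with any single nonnegative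
    upper bound [C], chosen to suit that disc. *)
Lemma pshI Om u : (forall z, Om z -> (u z < +oo)%E) -> usc_on Om u ->
  (forall a b, cdisc a b `<=` Om -> exists2 C : R, 0 <= C &
     (forall z, cdisc a b z -> (u z <= C%:E)%E) /\
     (circle_integral C u a b <= (2 * pi)%:E * (C%:E - u a))%E) ->
  psh Om u.
Proof.
move=> uy us um; split => // a b dO.
have {}dO : cdisc a b `<=` Om by move=> _ [p hp <-]; exact: dO.
by have [C C0 [uC]] := um a b dO; rewrite (submeanE us dO C0 uC).
Qed.

Lemma le_circle_integral Om1 Om2 u v a b (C : R) : usc_on Om1 u -> usc_on Om2 v ->
  cdisc a b `<=` Om1 -> cdisc a b `<=` Om2 ->
  (forall z, cdisc a b z -> u z <= v z)%E ->
  (forall z, cdisc a b z -> (v z <= C%:E)%E) ->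
  (circle_integral C v a b <= circle_integral C u a b)%E.
Proof.
move=> us vs d1 d2 uv vC; apply: ge0_le_integral => //.
- by move=> t _; rewrite subre_ge0//; exact/vC/cdisc_circ.
- by apply: measurable_funTS; exact: usc_circ_measurableB vs d2.
- by apply: measurable_funTS; exact: usc_circ_measurableB us d1.
- by move=> t _; apply: leeB => //; exact/uv/cdisc_circ.
Qed.

Lemma psh_subset Om Om' u : Om' `<=` Om -> psh Om u -> psh Om' u.
Proof.
move=> sO [uy us um]; split => [z /sO/uy//|z /sO/us//|a b h].
by apply: um => x y /h/sO.
Qed.

(** Semicontinuity at a point of [Om] looks at a full neighbourhood, so openness is what transfers
    it between functions that agree on [Om] only. *)
Lemma psh_ext Om u v : open Om -> (forall z, Om z -> u z = v z) ->
  psh Om u -> psh Om v.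
Proof.
move=> oO uv [uy us um]; split => [z Oz|z Oz c|a b h].
- by rewrite -uv// uy.
- rewrite -uv// => /(us _ Oz); apply: filterS2 (open_nbhs_nbhs (conj oO Oz)).
  by move=> w /uv ->.
- have Oa : Om a by have := h 0 0; rewrite cline0; apply; rewrite expr0n/= addr0.
  rewrite -uv//; apply: (le_trans (um a b h)); rewrite le_eqVlt; apply/orP; left.
  apply/eqP; congr (_ * _)%E; apply: eq_integral => t _.
  by apply: uv; apply: h; rewrite cos2Dsin2.
Qed.

Lemma psh_max Om u v : psh Om u -> psh Om v ->
  psh Om (fun z => Order.max (u z) (v z)).
Proof.
move=> pu pv; have [uy us _] := pu; have [vy vs _] := pv.
have wy z : Om z -> (Order.max (u z) (v z) < +oo)%E.
  by move=> Oz; rewrite gt_max uy// vy.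
have ws : usc_on Om (fun z => Order.max (u z) (v z)).
  move=> z Oz c; rewrite gt_max => /andP[/(us _ Oz) h1 /(vs _ Oz) h2].
  by apply: filterS2 h1 h2 => w h1 h2; rewrite gt_max h1 h2.
apply: pshI => // a b dO; have [C C0 wC] := usc_disc_bounded ws wy dO.
exists C => //; split => //.
have [uC vC] : (forall z, cdisc a b z -> (u z <= C%:E)%E) /\
    (forall z, cdisc a b z -> (v z <= C%:E)%E).
  by split => z /wC; rewrite ge_max => /andP[].
(* At the centre the maximum is one of the two functions; passing from that one to the maximum on
   the circle only decreases the integral of the difference with [C]. *)
have [uv|uv] := leP (u a) (v a).
  apply: le_trans (psh_submean pv dO C0 vC).
  apply: (le_circle_integral vs ws dO dO _ wC) => z _; by rewrite le_max lexx orbT.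
apply: le_trans (psh_submean pu dO C0 uC).
by apply: (le_circle_integral us ws dO dO _ wC) => z _; rewrite le_max lexx.
Qed.

Lemma psh_affine Om u (k c : R) : 0 < k -> psh Om u ->
  psh Om (fun z => k%:E * u z + c%:E)%E.
Proof.
move=> k0 pu; have [uy us _] := pu.
have E x (y : R) : (k%:E * x + c%:E < y%:E)%E = (x < ((y - c) / k)%:E)%E.
  case: x => [x| |].
  - by rewrite -EFinM -EFinD !lte_fin ltr_pdivlMr//; apply/idP/idP; lra.
  - by rewrite mulry gtr0_sg// mul1e.
  - by rewrite mulrNy gtr0_sg// mul1e !ltNyr.
apply: pshI => [z /uy||a b dO].
- case: (u z) => [x _| |_]//; first by rewrite -EFinM -EFinD ltry.
  by rewrite mulrNy gtr0_sg// mul1e addNye.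
- move=> z Oz y; rewrite E => /(us _ Oz); apply: filterS => w.
  by rewrite E.
have [C C0 uC] := usc_disc_bounded us uy dO.
have F (C' : R) x : ((k * C' + c)%:E - (k%:E * x + c%:E) = k%:E * (C'%:E - x))%E.
  case: x => [x| |].
  - by rewrite -EFinM -!EFinD -EFinM; congr _%:E; lra.
  - by rewrite mulry gtr0_sg// mul1e /= mulrNy gtr0_sg// mul1e.
  - by rewrite mulrNy gtr0_sg// mul1e /= mulry gtr0_sg// mul1e.
(* Enlarging the bound by [|c| / k] makes [k * C' + c], the bound for the new function, nonnegative
   whatever the sign of [c]. *)
pose C' : R := C + `|c| / k.
have CC' : C <= C' by rewrite lerDl divr_ge0// ltW.
have C'0 : 0 <= C' by exact: le_trans CC'.
have uC' z : cdisc a b z -> (u z <= C'%:E)%E.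
  by move=> /uC h; apply: (le_trans h); rewrite lee_fin.
have kC' : 0 <= k * C' + c.
  rewrite mulrDr mulrCA divff ?gt_eqF// mulr1.
  have : 0 <= k * C by rewrite mulr_ge0// ltW.
  by have := ler_norm (- c); rewrite normrN; lra.
exists (k * C' + c) => //; split => [z /uC' h|].
  by rewrite -subre_ge0// F mule_ge0 ?subre_ge0// lee_fin ltW.
rewrite /circle_integral F; under eq_integral do rewrite F.
rewrite ge0_integralZl//.
- rewrite muleCA; apply: lee_wpmul2l; first by rewrite lee_fin ltW.
  exact: psh_submean pu dO C'0 uC'.
- by apply: measurable_funTS; exact: usc_circ_measurableB us dO.
- by move=> t _; rewrite subre_ge0//; exact/uC'/cdisc_circ.
- by rewrite lee_fin ltW.
Qed.

End psh_basics.

(** * Lower semicontinuity of integrals with a parameter *)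

Section lsc_integral.
Variable R : realType.
Local Notation mu := (@lebesgue_measure R).

Lemma lee_real_lt (x y : \bar R) :
  (forall a : R, a%:E < x -> a%:E <= y)%E -> (x <= y)%E.
Proof.
move=> h; rewrite leNgt; apply/negP.
case: y h => [r| |] h; case: x h => [s| |]// h.
- rewrite lte_fin => rs; have := h ((r + s) / 2).
  by rewrite lte_fin lee_fin => /(_ ltac:(lra)); lra.
- by have := h (r + 1) (ltry _); rewrite lee_fin leNgt ltrDl ltr01.
- by have := h (s - 1); rewrite lte_fin => /(_ ltac:(lra)).
- by have := h 0 (ltry 0).
Qed.

Lemma lsc_limn_einf (X : topologicalType) (f : X -> \bar R) (x_ : nat -> X) x :
  lower_semicontinuous f -> x_ @ \oo --> x -> (f x <= limn_einf (f \o x_))%E.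
Proof.
move=> lf xx; apply: lee_real_lt => a /lf[V /xx[N _ NV] Va].
rewrite limn_einf_lim (cvg_lim _ (@cvg_einfs_sup R (f \o x_)))//.
apply: le_trans (ereal_sup_ubound (ex_intro2 _ _ N I erefl)).
apply: le_ereal_inf_tmp => _ [k /= Nk <-]; apply/ltW/Va; exact: NV.
Qed.

Lemma lsc_section (f : R * R -> \bar R) r : lower_semicontinuous f ->
  lower_semicontinuous (fun s => f (r, s)).
Proof.
move=> lf; apply: (lsc_comp (g := fun s => (r, s))) lf.
by apply: continuous_pair; [exact: cst_continuous|move=> ?; exact: cvg_id].
Qed.

(** Fatou's lemma along a sequence: if the claim fails at [r] for the level [c], some [r_ k] tend to
    [r] with integrals at most [c], and the integral at [r] is at most the integral of the lower
    limit, hence at most [c]. *)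
Lemma lsc_integral (D : set R) (f : R * R -> \bar R) : measurable D ->
  lower_semicontinuous f -> (forall p, 0 <= f p)%E ->
  lower_semicontinuous (fun r => \int[mu]_(s in D) f (r, s))%E.
Proof.
move=> mD lf f0 r c cr; apply: contrapT => nV.
have /choice[r_ rP] : forall k, exists s : R, ball r k.+1%:R^-1 s /\
    (\int[mu]_(t in D) f (s, t) <= c%:E)%E.
  move=> k; apply: contrapT => nk; apply: nV; exists (ball r k.+1%:R^-1).
    by apply: nbhsx_ballx; rewrite invr_gt0.
  by move=> s bs; rewrite ltNge; apply/negP => h; apply: nk; exists s.
have cvr : r_ @ \oo --> r.
  apply/cvgrPdist_lt => e e0; near=> k; have [/= + _] := rP k.
  rewrite /ball/= => /lt_trans; apply; near: k; exact: near_infty_natSinv_lt (PosNum e0).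
move: cr; rewrite ltNge => /negP; apply.
have mf k : measurable_fun D (fun s => f (r_ k, s)).
  by apply: measurable_funTS; apply: lower_semicontinuous_measurable; exact: lsc_section.
have L := @fatou _ _ _ mu D mD (fun k s => f (r_ k, s)) mf (fun k s _ => f0 (r_ k, s)).
apply: (@le_trans _ _ (\int[mu]_(s in D) limn_einf (fun k => f (r_ k, s)))%E).
  apply: ge0_le_integral => //.
  - apply: measurable_funTS; apply: lower_semicontinuous_measurable.
    exact: lsc_section.
  - rewrite /limn_einf; apply: measurableT_comp => //.
    apply: measurable_fun_limn_esup => k; apply: (measurableT_comp _ (mf k)).
    exact: oppe_measurable.
  - move=> s _; apply: (@lsc_limn_einf _ f (fun k => (r_ k, s))) => //.
    by apply: (@cvg_pair _ _ _ _ (nbhs r) (nbhs s)) => //; exact: cvg_cst.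
apply: (le_trans L); rewrite limn_einf_lim (cvg_lim _ (@cvg_einfs_sup R _))//.
apply: ge_ereal_sup => _ [k _ <-]; apply: le_trans (proj2 (rP k)).
by apply: ereal_inf_lbound; exists k => /=.
Unshelve. all: end_near. Qed.

End lsc_integral.

(** * Translation, periodicity and polar coordinates *)

Section rotation.
Variable R : realType.
Local Notation mu := (@lebesgue_measure R).
Local Notation I2pi := (`[0%R, (2 * pi)%R]%classic : set R).

(** Lebesgue measure is determined by its values on half-open intervals, and a translation keeps
    their lengths. *)
Lemma lebesgue_measureD (c : R) (A : set R) : measurable A ->
  pushforward mu ((fun x => x + c) : _ -> measurableTypeR R) A = mu A.
Proof.
move=> mA; apply/esym/lebesgue_measure_unique => //=.
  exact: measurable_funD.
move=> _ _ [[a b]] _ <-; rewrite /pushforward.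
have -> : (fun x => x + c) @^-1` `]a, b] = `](a - c), (b - c)]%classic.
  by apply/seteqP; split => x /=; rewrite !in_itv/=; lra.
rewrite !lebesgue_measure_itv/= !lte_fin ltrD2r.
by case: ifP => // _; congr _%:E; lra.
Qed.

Lemma ge0_integral_shift (c : R) (D : set R) (f : R -> \bar R) :
  measurable D -> measurable_fun setT f -> (forall x, 0 <= f x)%E ->
  (\int[mu]_(x in D) f x =
   \int[mu]_(x in (fun x => (x + c)%R) @^-1` D) f (x + c)%R)%E.
Proof.
move=> mD mf f0.
have mphi : measurable_fun setT
    ((fun x => x + c) : measurableTypeR R -> measurableTypeR R).
  exact: measurable_funD.
rewrite -[RHS](ge0_integral_pushforward mphi mu mD (f := f))//.
  by apply: eq_measure_integral => A mA _; exact/esym/lebesgue_measureD.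
exact: measurable_funTS.
Qed.

(** The shifted integral runs over [[c, p + c[]; its part over [[p, p + c[] is moved back by one
    period to [[0, c[]. Half-open intervals make the pieces disjoint. *)
Lemma integral_period (f : R -> \bar R) (c : R) :
  measurable_fun setT f -> (forall x, 0 <= f x)%E ->
  (forall x, f (x + 2 * pi) = f x) -> 0 <= c <= 2 * pi ->
  (\int[mu]_(x in I2pi) f (x + c)%R = \int[mu]_(x in I2pi) f x)%E.
Proof.
move=> mf f0 fp /andP[c0 c2].
have p0 := twopi_gt0 R; set p := 2 * pi in fp c2 p0 *.
have mfc : measurable_fun setT (fun x : R => f (x + c)).
  by apply: measurableT_comp => //; exact: measurable_funD.
have co (g : R -> \bar R) : measurable_fun setT g ->
  (\int[mu]_(x in `[0%R, p]) g x = \int[mu]_(x in `[0%R, p[) g x)%E.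
  by move=> mg; rewrite integral_itv_bndo_bndc//; exact: measurable_funTS.
rewrite !co//.
transitivity (\int[mu]_(x in `[c, (p + c)%R[) f x)%E.
  rewrite [RHS](ge0_integral_shift c)//; congr integral.
  by apply/seteqP; split => x /=; rewrite !in_itv/=; lra.
have dj (a b d : itv_bound R) : [disjoint [set` Interval a b] & [set` Interval b d]].
  apply/disj_setPS => x /= [].
  rewrite !itv_boundlr => /andP[_ h1] /andP[h2 _].
  by have := le_trans h1 h2; rewrite bnd_simp ltxx.
have mS D : measurable_fun D f by exact: measurable_funTS.
rewrite (@itv_bndbnd_setU _ _ _ (BLeft p)) ?bnd_simp//; last lra.
rewrite ge0_integral_setU//; last exact: mS.
rewrite [X in (_ + X)%E](@ge0_integral_shift p)//.
have -> : (fun x => x + p) @^-1` `[p, (p + c)[ = `[0, c[%classic.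
  by apply/seteqP; split => x /=; rewrite !in_itv/=; lra.
under [X in (_ + X)%E]eq_integral do rewrite fp.
rewrite (@itv_bndbnd_setU _ _ (BLeft 0) (BLeft c) (BLeft p)) ?bnd_simp//.
by rewrite ge0_integral_setU//; [exact: addeC|exact: mS].
Qed.

(** The angle is [acos (x / rho)] in the closed upper half-plane and [2 * pi] minus it below. Its
    range matches the shifts allowed in [integral_period]. *)
Lemma polarP (x y : R) : exists2 th, 0 <= th <= 2 * pi &
  x = Num.sqrt (x ^+ 2 + y ^+ 2) * cos th /\ y = Num.sqrt (x ^+ 2 + y ^+ 2) * sin th.
Proof.
have p0 := pi_gt0 R.
set rho := Num.sqrt _.
have r2 : rho ^+ 2 = x ^+ 2 + y ^+ 2 by rewrite sqr_sqrtr// addr_ge0 ?sqr_ge0.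
have r0 : 0 <= rho by exact: sqrtr_ge0.
have [rz|rnz] := eqVneq rho 0.
  exists 0; first by lra.
  rewrite rz !mul0r; move: r2; rewrite rz expr0n/= => /esym/eqP.
  by rewrite paddr_eq0 ?sqr_ge0// !sqrf_eq0 => /andP[/eqP -> /eqP ->].
have rp : 0 < rho by rewrite lt_def rnz r0.
have cb : -1 <= x / rho <= 1.
  by rewrite ler_pdivlMr// ler_pdivrMr//; nra.
have xE : x = rho * (x / rho) by field.
have ac : cos (acos (x / rho)) = x / rho by rewrite acosK// in_itv.
have as_ : sin (acos (x / rho)) = `|y| / rho.
  rewrite sin_acos//; have -> : 1 - (x / rho) ^+ 2 = (y / rho) ^+ 2.
    rewrite !expr_div_n; apply: (mulIf (expf_neq0 2 rnz)).
    by rewrite mulrBl !divfK ?expf_neq0// mul1r r2; ring.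
  by rewrite sqrtr_sqr normrM normfV (gtr0_norm rp).
have a0 := acos_ge0 cb; have a1 := acos_lepi cb.
have [y0|y0] := leP 0 y.
  exists (acos (x / rho)); first by lra.
  by rewrite ac as_ ger0_norm//; split; field.
exists (2 * pi - acos (x / rho)); first by lra.
have E2 : 2 * pi - acos (x / rho) = - acos (x / rho) + pi *+ 2.
  by rewrite mulr_natl addrC.
by rewrite E2 cosD2pi sinD2pi cosN sinN ac as_ ltr0_norm//; split; field.
Qed.

End rotation.

(** * The minimum principle for radial means *)

Section minimum_principle.
Variable R : realType.
Local Notation mu := (@lebesgue_measure R).
Local Notation I2pi := (`[0%R, (2 * pi)%R]%classic : set R).

(** A lower semicontinuous function attains its infimum on a compact interval, and its minimisers
    form a compact set, which has a largest element. One finite value makes the minimum finite. *)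
Lemma lsc_last_argmin (f : R -> \bar R) (a b : R) : lower_semicontinuous f ->
  (forall r, 0 <= f r)%E -> (exists2 r, a <= r <= b & (f r < +oo)%E) ->
  exists r0 : R, [/\ a <= r0 <= b, f r0 \is a fin_num,
    forall r, a <= r <= b -> (f r0 <= f r)%E &
    forall r, a <= r <= b -> r0 < r -> (f r0 < f r)%E].
Proof.
move=> lf f0 [r1 r1ab fr1].
pose K := `[a, b]%classic : set R.
have KP r : K r = (a <= r <= b) by rewrite /K /= in_itv.
have Kr1 : K r1 by rewrite KP.
set m := ereal_inf (f @` K).
have mK r : K r -> (m <= f r)%E by move=> Kr; apply: ereal_inf_lbound; exists r.
have m0 : (0 <= m)%E by apply: le_ereal_inf_tmp => _ [r _ <-].
have mfin : m \is a fin_num.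
  by rewrite ge0_fin_numE// (le_lt_trans (mK _ Kr1)).
(* If the infimum [m] were not attained, each point would have a neighbourhood where [f] exceeds
   some real [c > m]; by compactness one such [c] would serve on all of [K]. *)
have [r2 Kr2 fr2] : exists2 r, K r & (f r <= m)%E.
  apply: contrapT => nr.
  have mf r : K r -> (m < f r)%E.
    by move=> Kr; rewrite ltNge; apply/negP => h; apply: nr; exists r.
  have /compact_near_coveringP cK : compact K by exact: segment_compact.
  have : \forall c \near (fine m)^'+, K `<=` (fun r => c%:E < f r)%E.
    apply: cK => r Kr.
    have [c mc cf] : exists2 c : R, fine m < c & (c%:E < f r)%E.
      move: (mf r Kr); rewrite -{1}(fineK mfin); case: (f r) => [s| |]//.
        rewrite lte_fin => ms; exists ((fine m + s) / 2); rewrite ?lte_fin; lra.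
      by move=> _; exists (fine m + 1); rewrite ?ltry// ltrDl.
    have [V rV Vc] := lf r c cf.
    exists (V, [set x | x < c]); first by split => //=; exact: nbhs_right_lt.
    by move=> [s x] /= [/Vc h1 h2]; apply: lt_trans h1; rewrite lte_fin.
  move=> h; have [c [/= mc cK']] : exists c, fine m < c /\ K `<=` (fun r => c%:E < f r)%E.
    apply: (@filter_ex _ (fine m)^'+); near=> c.
    by split; near: c => //; exact: nbhs_right_gt.
  have : (c%:E <= m)%E by apply: le_ereal_inf_tmp => _ [r /cK'/ltW h' <-].
  by rewrite -(fineK mfin) lee_fin leNgt mc.
pose B := K `&` [set r | (f r <= m)%E].
have cB : compact B.
  apply: (@subclosed_compact _ _ K); [|exact: segment_compact|by move=> ? []].
  apply: closedI; first exact: interval_closed.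
  rewrite -[X in closed X]setCK; apply: open_closedC.
  have -> : ~` [set r | (f r <= m)%E] = [set r | ((fine m)%:E < f r)%E].
    by apply/seteqP; split => r /=; rewrite fineK// ltNge => /negP.
  by move/lower_semicontinuousP : lf.
have [r0 /set_mem[Kr0 fr0] r0max] :=
  @compact_EVT_max _ R id B (ex_intro _ r2 (conj Kr2 fr2))
    cB (continuous_subspaceT (fun x => cvg_id)).
have fm : f r0 = m by apply/eqP; rewrite eq_le fr0 mK.
exists r0; split; rewrite ?fm// -?KP//.
move=> r; rewrite -KP => Kr rr0; rewrite ltNge; apply/negP => fr.
by have := r0max r (mem_set (conj Kr fr)); rewrite /= leNgt rr0.
Unshelve. all: end_near. Qed.

(** Tonelli's theorem on the whole plane, applied to [k] extended by zero outside the square. *)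
Lemma fubini_tonelli_in (D : set R) (k : R * R -> \bar R) :
  measurable D -> measurable_fun setT k -> (forall p, 0 <= k p)%E ->
  (\int[mu]_(s in D) \int[mu]_(t in D) k (s, t) =
   \int[mu]_(t in D) \int[mu]_(s in D) k (s, t))%E.
Proof.
move=> mD mk k0.
pose K := k \_ (D `*` D).
have mK : measurable_fun setT K.
  apply/(measurable_restrictT _ _).1; first exact: measurableX.
  exact: measurable_funTS.
have K0 p : (0 <= K p)%E by rewrite /K /patch; case: ifP.
have := @fubini_tonelli _ _ _ _ _ mu mu K mK K0.
have -> : (fun s => \int[mu]_t K (s, t))%E =
    (fun s => \int[mu]_(t in D) k (s, t))%E \_ D.
  apply/funext => s; rewrite [RHS]/patch; case: ifPn => sD.
    rewrite [RHS]integral_mkcond; apply: eq_integral => t _.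
    by rewrite /K /patch in_setX sD.
  by apply: integral0_eq => t _; rewrite /K /patch in_setX (negbTE sD).
have -> : (fun t => \int[mu]_s K (s, t))%E =
    (fun t => \int[mu]_(s in D) k (s, t))%E \_ D.
  apply/funext => s; rewrite [RHS]/patch; case: ifPn => sD.
    rewrite [RHS]integral_mkcond; apply: eq_integral => t _.
    by rewrite /K /patch in_setX sD andbT.
  by apply: integral0_eq => t _; rewrite /K /patch in_setX (negbTE sD) andbF.
by rewrite -!integral_mkcond.
Qed.

Variable F : R * R -> \bar R.
Hypothesis lF : lower_semicontinuous F.
Hypothesis F0 : forall p, (0 <= F p)%E.

Let m r := (\int[mu]_(s in I2pi) F (r * cos s, r * sin s)%R)%E.

(* [(r + d e^(it)) e^(is)] in real coordinates *)
Definition epicycle (r d s t : R) : R * R :=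
  (r * cos s + d * cos (s + t), r * sin s + d * sin (s + t)).

Lemma continuous_epicycle (r d : R) :
  continuous (fun p : R * R => epicycle r d p.1 p.2).
Proof.
have c1 : continuous (fun p : R * R => p.1 : R) by move=> p; exact: cvg_fst.
have c2 : continuous (fun p : R * R => p.2 : R) by move=> p; exact: cvg_snd.
have c12 : continuous (fun p : R * R => p.1 + p.2 : R).
  by move=> p; apply: cvgD; [exact: c1|exact: c2].
have cC (f : R -> R) (g : R * R -> R) : continuous f -> continuous g ->
  continuous (f \o g) by move=> cf cg p; apply: continuous_comp; [exact: cg|exact: cf].
apply: continuous_pair => p; apply: cvgD; apply: cvgMr; apply: cC => //;
  by [exact: continuous_cos|exact: continuous_sin].
Qed.

Lemma continuous_polar : continuous (fun p : R * R => (p.1 * cos p.2, p.1 * sin p.2)).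
Proof.
have c1 : continuous (fun p : R * R => p.1 : R) by move=> p; exact: cvg_fst.
have c2 : continuous (fun p : R * R => p.2 : R) by move=> p; exact: cvg_snd.
have cC (f : R -> R) (g : R * R -> R) : continuous f -> continuous g ->
  continuous (f \o g) by move=> cf cg p; apply: continuous_comp; [exact: cg|exact: cf].
apply: continuous_pair => p; apply: cvgM; by [exact: c1|
  apply: cC; by [exact: continuous_cos|exact: continuous_sin|exact: c2]].
Qed.

Lemma measurable_lsc_polar r : measurable_fun setT (fun s => F (r * cos s, r * sin s)).
Proof.
apply: lower_semicontinuous_measurable.
apply: (@lsc_section _ (fun p => F (p.1 * cos p.2, p.1 * sin p.2)) r).
exact: lsc_comp continuous_polar lF.
Qed.

(** For fixed [t] the point [(r + d e^(it)) e^(is)] runs over the circle of radius [|r + d e^(it)|];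
    the argument [th] of the first factor is a shift of [s], removed by periodicity. *)
Lemma integral_epicycle (r d t : R) :
  (\int[mu]_(s in I2pi) F (epicycle r d s t) =
   m (Num.sqrt ((r + d * cos t) ^+ 2 + (d * sin t) ^+ 2)))%E.
Proof.
have [th th2 [E1 E2]] := polarP (r + d * cos t) (d * sin t).
set rho := Num.sqrt _ in E1 E2 *.
rewrite /m -(@integral_period _ (fun s => F (rho * cos s, rho * sin s)) th)//.
- apply: eq_integral => s _; congr F; rewrite /epicycle !cosD !sinD.
  congr pair.
    transitivity (cos s * (r + d * cos t) - sin s * (d * sin t)); first ring.
    by rewrite E1 E2; ring.
  transitivity (sin s * (r + d * cos t) + cos s * (d * sin t)); first ring.
  by rewrite E1 E2; ring.
- exact: measurable_lsc_polar.
- by move=> x; rewrite mulr_natl cosD2pi sinD2pi.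
Qed.

(* The radial mean of [F] about the origin attains its minimum over [[0, 1]] at
   a largest radius; a small circle about a point at that radius reaches
   further out, which is incompatible with the averaged local inequality
   unless that radius is 1. *)
Lemma local_supermean_disc :
  (forall r, 0 <= r < 1 -> forall s, I2pi s -> \forall s' \near s & d \near 0^'+,
    (\int[mu]_(t in I2pi) F (epicycle r d s' t) <=
      (2 * pi)%:E * F (r * cos s', r * sin s')%R)%E) ->
  (\int[mu]_(t in I2pi) F (cos t, sin t) <= (2 * pi)%:E * F (0, 0)%R)%E.
Proof.
move=> loc; have p0 := twopi_gt0 R.
have mI : measurable I2pi by exact: measurable_itv.
have lm : lower_semicontinuous m.
  apply: (lsc_integral (f := fun p => F (p.1 * cos p.2, p.1 * sin p.2))) => //.
  exact: lsc_comp continuous_polar lF.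
have m_ge0 r : (0 <= m r)%E by exact: integral_ge0.
have -> : ((2 * pi)%:E * F (0, 0)%R = m 0%R)%E.
  rewrite /m; under eq_integral do rewrite !mul0r.
  rewrite (@integral_cst _ _ _ mu I2pi mI (F (0, 0))) muleC; congr (_ * _)%E.
  exact/esym/lebesgue_I2pi.
have -> : (\int[mu]_(t in I2pi) F (cos t, sin t) = m 1%R)%E.
  by rewrite /m; under [RHS]eq_integral do rewrite !mul1r.
rewrite leNgt; apply/negP => m01.
(* The negated goal [m 0 < m 1] makes [m 0] finite. It also excludes [r0 = 1], since the minimum is
   at most [m 0]. *)
have [r0 [/andP[r0_ge0 r0_le1] mr0 r0min r0last]] : exists r0 : R,
    [/\ 0 <= r0 <= 1, m r0 \is a fin_num,
    forall r, 0 <= r <= 1 -> (m r0 <= m r)%E &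
    forall r, 0 <= r <= 1 -> r0 < r -> (m r0 < m r)%E].
  apply: lsc_last_argmin => //; exists 0; first by rewrite lexx ler01.
  by rewrite (lt_le_trans m01) ?leey.
have r0_lt1 : r0 < 1.
  rewrite lt_neqAle r0_le1 andbT; apply/eqP => r01.
  have := r0min 0; rewrite lexx ler01 => /(_ isT).
  by rewrite r01 leNgt m01.
(* The local inequality holds for [s'] and [d] jointly, so compactness of the circle of centres
   provides one radius [d] valid for all of them. *)
have [d [d0 d1 dloc]] : exists d, [/\ 0 < d, d < 1 - r0 & forall s, I2pi s ->
    (\int[mu]_(t in I2pi) F (epicycle r0 d s t) <=
      (2 * pi)%:E * F (r0 * cos s, r0 * sin s)%R)%E].
  have /compact_near_coveringP cI : compact I2pi by exact: segment_compact.
  have h := cI _ _ _ _ (loc r0 (introT andP (conj r0_ge0 r0_lt1))).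
  apply: (@filter_ex _ 0^'+); near=> d; split; last by near: d; exact: h.
    by near: d; exact: nbhs_right_gt.
  by near: d; apply: nbhs_right_lt; lra.
pose h t := (\int[mu]_(s in I2pi) F (epicycle r0 d s t))%E.
have lE : lower_semicontinuous (fun p : R * R => F (epicycle r0 d p.1 p.2)).
  exact: lsc_comp (@continuous_epicycle r0 d) lF.
have mh : measurable_fun setT h.
  apply: lower_semicontinuous_measurable.
  apply: (lsc_integral (f := fun p => F (epicycle r0 d p.2 p.1))) => //.
  apply: (lsc_comp (g := fun p => (p.2, p.1)) _ lE).
  by apply: continuous_pair => p; [exact: cvg_snd|exact: cvg_fst].
(* The local inequality is integrated over the centres [s], and Tonelli exchanges the two angles. *)
have hint : (\int[mu]_(t in I2pi) h t <= (2 * pi)%:E * m r0)%E.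
  rewrite -(@fubini_tonelli_in I2pi (fun p => F (epicycle r0 d p.1 p.2)))//.
    rewrite -ge0_integralZl//; last by rewrite lee_fin ltW.
      apply: ge0_le_integral => //.
      - by move=> s _; exact: integral_ge0.
      - apply: measurable_funTS; apply: lower_semicontinuous_measurable.
        exact: (lsc_integral (f := fun p => F (epicycle r0 d p.1 p.2))).
      - apply: measurable_funTS; apply: emeasurable_funM => //.
        exact: measurable_lsc_polar.
    by apply: measurable_funTS; exact: measurable_lsc_polar.
  exact: lsc_measurable_prod.
pose rho t := Num.sqrt ((r0 + d * cos t) ^+ 2 + (d * sin t) ^+ 2).
have rho2 t : rho t ^+ 2 = r0 ^+ 2 + 2 * r0 * d * cos t + d ^+ 2.
  rewrite sqr_sqrtr ?addr_ge0 ?sqr_ge0//.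
  by rewrite !exprMn [sin t ^+ 2]sin2cos2; ring.
have rho01 t : 0 <= rho t <= 1.
  rewrite sqrtr_ge0/= -(@ler_pXn2r _ 2)// ?nnegrE ?sqrtr_ge0//.
  rewrite rho2 expr1n.
  have c1 := cos_le1 t; have : r0 * d * cos t <= r0 * d.
    by rewrite ler_piMr// mulr_ge0// ltW.
  nra.
have hm t : h t = m (rho t) by exact: integral_epicycle.
have hge t : (m r0 <= h t)%E by rewrite hm; exact: r0min.
(* This excess is nonnegative by minimality at [r0], while [hint] makes its integral at most zero;
   hence it vanishes almost everywhere. *)
pose g t := (h t - m r0)%E.
have g0 t : (0 <= g t)%E by rewrite /g sube_ge0 ?mr0// hge.
have mg : measurable_fun I2pi g.
  apply: measurable_funTS; apply: emeasurable_funB => //; exact: measurable_cst.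
have gint : (\int[mu]_(t in I2pi) `|g t| = 0)%E.
  under eq_integral do rewrite gee0_abs//.
  apply/eqP; rewrite eq_le integral_ge0 ?andbT//.
  have cfin : ((2 * pi)%:E * m r0)%E \is a fin_num by rewrite fin_numM.
  rewrite -(@leeD2rE _ ((2 * pi)%:E * m r0)%E)// add0e.
  apply: le_trans hint.
  rewrite [X in (_ + X)%E](_ : _ = \int[mu]_(t in I2pi) cst (m r0) t)%E.
    rewrite -ge0_integralD//.
      by rewrite le_eqVlt; apply/orP; left; apply/eqP/eq_integral => t _; rewrite subeK.
    by move=> t _; exact: m_ge0.
  rewrite (@integral_cst _ _ _ mu I2pi mI (m r0)) muleC; congr (_ * _)%E.
  exact/esym/lebesgue_I2pi.
have [/= N [mN N0 gN]] := (ae_eq_integral_abs mu mI mg).1 gint.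
(* Since [1 <= pi / 2], the cosine is nonnegative on [[0, 1]], so [rho t > r0] there and [g t > 0]
   because [r0] is the last minimiser. An interval of length one would then lie in a null set. *)
have sub : `[0, 1]%classic `<=` N.
  move=> t /=; rewrite in_itv/= => /andP[t0 t1]; apply: gN => /= gt0.
  have pi2 := pihalf_ge1 R.
  have ct : 0 <= cos t by apply: cos_ge0_pihalf; lra.
  have rt : r0 < rho t.
    rewrite -(@ltr_pXn2r _ 2)// ?nnegrE ?sqrtr_ge0// rho2.
    have : 0 <= r0 * d * cos t by rewrite !mulr_ge0// ltW.
    have : 0 < d ^+ 2 by rewrite exprn_gt0.
    by lra.
  have := r0last _ (rho01 t) rt; rewrite -hm -sube_gt0.
  have := gt0; rewrite /g /= in_itv/= => ->; last lra.
  by rewrite ltxx.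
have : (mu `[0%R, 1%R]%classic <= mu N)%E.
  by apply: le_measure => //; rewrite inE.
by rewrite N0 lebesgue_measure_itv/= lte_fin ltr01 oppr0 addr0 lee_fin ler10.
Unshelve. all: end_near. Qed.

End minimum_principle.

(** * Plurisubharmonicity is a local property *)

Section psh_local.
Variables (R : realType) (n : nat).
Implicit Types (Om : set (Cn R n)) (u v : Cn R n -> \bar R).
Local Notation mu := (@lebesgue_measure R).
Local Notation I2pi := (`[0%R, (2 * pi)%R]%classic : set R).

(** In the complex parameter of the line this is [(x + iy) + (p + iq)(X + iY)]. *)
Lemma cline_comp (a b : Cn R n) (x y p q X Y : R) :
  cline (cline a b x y) (cline 0 b p q) X Y =
  cline a b (x + (p * X - q * Y)) (y + (p * Y + q * X)).
Proof.
rewrite /cline /= !add0r; congr pair; apply/rowP => i; rewrite !mxE; ring.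
Qed.

Lemma near_cdisc (V : set (Cn R n)) z : open V -> V z ->
  \forall z' \near z & b \near (0 : Cn R n), cdisc z' b `<=` V.
Proof.
move=> oV Vz; have /nbhs_ballP[e /= e0 eV] : nbhs z V by exact: open_nbhs_nbhs.
(* In each component a point of the disc differs from [z'] by two terms of norm below [e / 4], and
   [z'] from [z] by less than [e / 2]. *)
exists (ball z (e / 2), ball (0 : Cn R n) (e / 4)).
  by split => /=; apply: nbhsx_ballx; rewrite divr_gt0.
move=> [z' b] /= [[zz1 zz2] [b1 b2]] _ [[x y] /= xy <-].
move: zz1 zz2 b1 b2; rewrite -!ball_normE /= !sub0r !normrN => zz1 zz2 b1 b2.
have x1 : `|x| <= 1 by rewrite ler_norml; nra.
have y1 : `|y| <= 1 by rewrite ler_norml; nra.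
have Z (k : R) (c : 'rV[R]_n) : `|k| <= 1 -> `|c| < e / 4 -> `|k *: c| < e / 4.
  by move=> k1 ce; rewrite normrZ; apply: le_lt_trans ce; rewrite ler_piMl.
have A (c c' d d' : 'rV[R]_n) : `|c - c'| < e / 2 -> `|d| < e / 4 ->
    `|d'| < e / 4 -> `|c - (c' + d + d')| < e.
  move=> h1 h2 h3; have -> : c - (c' + d + d') = (c - c') - d - d'.
    by rewrite !opprD !addrA.
  apply: le_lt_trans (ler_normB _ _) _.
  apply: (@lt_le_trans _ _ (e / 2 + e / 4 + e / 4)); last lra.
  by rewrite ltrD// (le_lt_trans (ler_normB _ _))// ltrD.
apply: eV; split; rewrite -ball_normE /=; apply: A => //; rewrite ?normrN; exact: Z.
Qed.

Lemma psh_local Om u : open Om ->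
  (forall z, Om z -> exists V, [/\ open V, V z & psh V u]) -> psh Om u.
Proof.
move=> oO loc.
have uy z : Om z -> (u z < +oo)%E by move=> /loc[V [_ Vz [uy _ _]]]; exact: uy.
have us : usc_on Om u by move=> z /loc[V [_ Vz [_ us _]]]; exact: us.
apply: pshI => // a b dO; have [C C0 uC] := usc_disc_bounded us uy dO.
exists C => //; split => //.
(* The value [+oo] off the closed unit disc keeps the function nonnegative and lower semicontinuous
   on the whole plane, as the complement of the disc is open. *)
pose F (p : R * R) := if p.1 ^+ 2 + p.2 ^+ 2 <= 1
  then (C%:E - u (cline a b p.1 p.2))%E else +oo%E.
have dP p : p.1 ^+ 2 + p.2 ^+ 2 <= 1 -> cdisc a b (cline a b p.1 p.2).
  by move=> hp; exists p.
have F0 p : (0 <= F p)%E.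
  by rewrite /F; case: ifP => // /dP/uC; rewrite subre_ge0.
have lF : lower_semicontinuous F.
  move=> p c cF; move: (cF); rewrite {1}/F; case: ifPn => hp cp.
    rewrite lte_EFinB in cp.
    exists ((fun p => cline a b p.1 p.2) @^-1` [set w | u w < (C - c)%:E]%E).
      apply: cline_continuous; exact: us (dO _ (dP _ hp)) _ cp.
    by move=> q /= hq; rewrite /F; case: ifP => _; rewrite ?ltry// lte_EFinB.
  exists [set p | 1 < p.1 ^+ 2 + p.2 ^+ 2].
    apply: open_nbhs_nbhs; split; last by rewrite /= ltNge.
    have -> : [set p : R * R | 1 < p.1 ^+ 2 + p.2 ^+ 2] =
        ~` [set p | p.1 ^+ 2 + p.2 ^+ 2 <= 1].
      by apply/seteqP; split => q /=; rewrite ltNge => /negP.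
    apply: closed_openC; apply: compact_closed; last exact: compact_unit_disc.
    exact: norm_hausdorff.
  by move=> q /=; rewrite ltNge /F => /negbTE ->; rewrite ltry.
have FE p : p.1 ^+ 2 + p.2 ^+ 2 <= 1 -> F p = (C%:E - u (cline a b p.1 p.2))%E.
  by rewrite /F => ->.
have cs s : sin s ^+ 2 = 1 - cos s ^+ 2 :> R by exact: sin2cos2.
have := local_supermean_disc lF F0.
rewrite [F (0, 0)%R]FE/= ?expr0n ?addr0// cline0.
under eq_integral do rewrite FE/= ?cos2Dsin2//; apply.
move=> r /andP[r0 r1] s _.
pose z s := cline a b (r * cos s) (r * sin s).
have [V [oV Vz pV]] : exists V, [/\ open V, V (z s) & psh V u].
  apply/loc/dO/(dP (r * cos s, r * sin s)) => /=.
  rewrite !exprMn cs; nra.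
have cz : z s' @[s' --> s] --> z s.
  apply: (@continuous_comp _ _ _ (fun s => (r * cos s, r * sin s))
    (fun p => cline a b p.1 p.2)); last exact: cline_continuous.
  by apply: continuous_pair => x; apply: cvgMr;
    [exact: continuous_cos|exact: continuous_sin].
(* The direction [d e^(is) b]: the circle about [z s] with this direction is the image of the
   epicycle [(r + d e^(it)) e^(is)], and it shrinks with [d]. *)
pose B (p : R * R) : Cn R n := cline 0 b (p.2 * cos p.1) (p.2 * sin p.1).
have cB : B p @[p --> (s, 0)] --> (0 : Cn R n).
  have <- : B (s, 0) = 0 by rewrite /B /= !mul0r cline0.
  apply: (@continuous_comp _ _ _ (fun p : R * R => (p.2 * cos p.1, p.2 * sin p.1))
    (fun p => cline 0 b p.1 p.2)); last exact: cline_continuous.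
  have := @continuous_comp _ _ _ (fun p : R * R => (p.2, p.1)) _ _ _
    (@continuous_polar R _).
  by apply; apply: continuous_pair => x; [exact: cvg_snd|exact: cvg_fst].
have [[V1 V2] /= [V1z V20] V12] := near_cdisc oV Vz.
have [[S1 D1] /= [S1s D10] SD1] := cB _ V20.
have S2s := cz _ V1z.
near=> s' d => /=.
have d0 : 0 < d by near: d; exact: nbhs_right_gt.
have d1 : d < 1 - r by near: d; apply: nbhs_right_lt; rewrite subr_gt0.
have inV : cdisc (z s') (B (s', d)) `<=` V.
  apply: (V12 (z s', B (s', d))); split => /=.
    by near: s'; exact: S2s.
  apply: (SD1 (s', d)); split => /=; first by near: s'.
  by near: d; exact: cvg_within.
have clE (X Y : R) : cline (z s') (B (s', d)) X Y =
    cline a b (r * cos s' + (d * cos s' * X - d * sin s' * Y))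
              (r * sin s' + (d * cos s' * Y + d * sin s' * X)).
  exact: cline_comp.
(* Rotation by [s'] preserves the modulus, and [|r + d (X + iY)| <= r + d <= 1]; so the small disc
   stays where [F] is [C - u]. *)
have in1 (X Y : R) : X ^+ 2 + Y ^+ 2 <= 1 ->
    (r * cos s' + (d * cos s' * X - d * sin s' * Y)) ^+ 2 +
    (r * sin s' + (d * cos s' * Y + d * sin s' * X)) ^+ 2 <= 1.
  move=> XY; have -> : (r * cos s' + (d * cos s' * X - d * sin s' * Y)) ^+ 2 +
    (r * sin s' + (d * cos s' * Y + d * sin s' * X)) ^+ 2 =
    (cos s' ^+ 2 + sin s' ^+ 2) * ((r + d * X) ^+ 2 + (d * Y) ^+ 2) by ring.
  rewrite cos2Dsin2 mul1r.
  have X1 : X <= 1 by nra.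
  have h1 : r * d * X <= r * d by rewrite ler_piMr// mulr_ge0// ltW.
  have h2 : d ^+ 2 * (X ^+ 2 + Y ^+ 2) <= d ^+ 2 by rewrite ler_piMr// sqr_ge0.
  have h3 : (r + d) ^+ 2 <= 1 by nra.
  lra.
have uC' w : cdisc (z s') (B (s', d)) w -> (u w <= C%:E)%E.
  move=> [[X Y] /= XY <-]; rewrite clE; apply: uC.
  by exists (r * cos s' + (d * cos s' * X - d * sin s' * Y),
             r * sin s' + (d * cos s' * Y + d * sin s' * X)) => //=; exact: in1.
have epi t :
    (epicycle r d s' t).1 = r * cos s' + (d * cos s' * cos t - d * sin s' * sin t)
    /\ (epicycle r d s' t).2 = r * sin s' + (d * cos s' * sin t + d * sin s' * cos t).
  by rewrite /epicycle /= cosD sinD; split; ring.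
rewrite FE /=; last by rewrite !exprMn cs; nra.
apply: le_trans (psh_submean pV inV C0 uC'); rewrite le_eqVlt; apply/orP; left.
apply/eqP/eq_integral => t _; rewrite clE FE; have [-> ->] := epi t => //.
by apply: in1; rewrite cos2Dsin2.
Unshelve. all: end_near. Qed.

End psh_local.

(** * Lower bounds away from the poles *)

Section poles.
Variables (R : realType) (n : nat).
Implicit Types (u : Cn R n -> \bar R).
Local Notation mu := (@lebesgue_measure R).
Local Notation I2pi := (`[0%R, (2 * pi)%R]%classic : set R).

Lemma cline_to (z w : Cn R n) : cline z (w - z) 1 0 = w.
Proof.
rewrite /cline !scale1r !scale0r subr0 addr0.
by move: z w => [z1 z2] [w1 w2]/=; congr pair; rewrite addrC subrK.
Qed.

(* Poles near [z] would form an open set, and a circle about [z] meeting it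
   would have mean value [-oo]. *)
Lemma psh_bounded_below_near u (G : set (Cn R n)) z (M : R) :
  open G -> psh G u -> G z -> u z != -oo%E ->
  (\forall w \near z, u w != -oo%E -> (- M%:E <= u w)%E) ->
  \forall w \near z, (- M%:E <= u w)%E.
Proof.
move=> oG pu Gz uz nM; have [uy us _] := pu.
(* In [V] every value of [u] is either [-oo] or at least [- M], so a value below [- M] is a pole. *)
have [V [oV Vz VG VM]] : exists V, [/\ open V, V z, V `<=` G &
    forall w, V w -> u w != -oo%E -> (- M%:E <= u w)%E].
  exists (G `&` [set w | u w != -oo%E -> (- M%:E <= u w)%E]°); split.
  - by apply: openI => //; exact: open_interior.
  - by split.
  - by move=> w [].
  - by move=> w [_ /interior_subset].
have [[V1 V2] /= [/nbhs_singleton V1z V20] V12] := near_cdisc oV Vz.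
have cb : (fun w => w - z) w @[w --> z] --> (0 : Cn R n).
  by rewrite -(subrr z); apply: cvgB; [exact: cvg_id|exact: cvg_cst].
near=> w; have V2w : V2 (w - z) by near: w; exact: cb _ V20.
rewrite leNgt; apply/negP => uwM.
have dV : cdisc z (w - z) `<=` V by exact: (V12 (z, w - z) (conj V1z V2w)).
have cw := cline_to z w.
have us1 : usc_on V u by move=> x /VG; exact: us.
have uy1 x : V x -> (u x < +oo)%E by move=> /VG/uy.
have [C C0 uC] := usc_disc_bounded us1 uy1 dV.
have := psh_submean (psh_subset VG pu) dV C0 uC.
have lc := @usc_comp_lsc _ _ _ _ 0 _ _ us1 (@circ_continuous _ _ z (w - z))
  (fun t => dV _ (@cdisc_circ _ _ z (w - z) t)).
(* The circle passes through [w] at [t = 0], where [u < - M]; by semicontinuity this persists for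
   small [t], which makes these points poles. *)
have [U0 U0n U0M] : exists2 U0 : set R, nbhs 0 U0 &
    forall t, U0 t -> (u (cline z (w - z)%R (cos t) (sin t)) = -oo)%E.
  have [|U0 U0n U0M] := lc 0 M.
    by rewrite cos0 sin0 cw add0e lteNr.
  exists U0 => // t /U0M; rewrite add0e lteNr => h.
  apply/eqP; apply: contraPT h => h; apply/negP; rewrite -leNgt.
  by apply: VM => //; apply: dV; exact: cdisc_circ.
have /nbhs_ballP[e /= e0 eU] := U0n.
(* The interval [[0, s]] lies both in the neighbourhood found above and in [[0, 2 * pi]]. The
   integral of [C - u] over it is already [+oo], whereas [u z] is finite. *)
pose s := Num.min (e / 2) 1.
have s0 : 0 < s by rewrite lt_min ltr01 divr_gt0.
have s1 : s <= 1 by rewrite ge_min lexx orbT.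
have se : s <= e / 2 by rewrite ge_min lexx.
have p2 := pi_ge2 R.
rewrite leNgt => /negP; apply.
apply: (@lt_le_trans _ _ +oo%E).
  have := uC _ (cdisc_center z (w - z)); case: (u z) uz => [x| |]// _ _.
  by rewrite -EFinD -EFinM ltry.
have mC := usc_circ_measurableB C us1 dV.
apply: (@le_trans _ _ (\int[mu]_(t in `[0%R, s])
  (C%:E - u (cline z (w - z)%R (cos t) (sin t))))%E).
  have -> : (\int[mu]_(t in `[0%R, s]) (C%:E - u (cline z (w - z)%R (cos t) (sin t))) =
     \int[mu]_(t in `[0%R, s]) cst +oo t)%E.
    apply: eq_integral => t; rewrite inE /= in_itv/= => /andP[t0 ts].
    rewrite U0M//; apply: eU; rewrite /ball/= sub0r normrN ger0_norm//; lra.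
  rewrite (integral_cst mu)// [X in (_ * X)%E]lebesgue_measure_itv/= lte_fin s0.
  by rewrite oppr0 addr0 mulyr gtr0_sg// mul1e.
apply: ge0_subset_integral => //.
- exact: measurable_funTS.
- by move=> t _; rewrite subre_ge0//; exact/uC/cdisc_circ.
- by move=> t /=; rewrite !in_itv/=; lra.
Unshelve. all: end_near. Qed.

(** The set of points near which a bound holds is itself a neighbourhood, so finitely many bounds
    suffice. The conclusion keeps neighbourhoods because gluing needs the bound on an open set. *)
Lemma bounded_below_near_compact u (K : set (Cn R n)) : compact K ->
  (forall z, K z -> exists M : R, \forall w \near z, (- M%:E <= u w)%E) ->
  exists2 M : R, 0 <= M & forall z, K z -> \forall w \near z, (- M%:E <= u w)%E.
Proof.
move=> /compact_near_coveringP cK h.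
have {}h : \forall M \near +oo, K `<=` (fun z => \forall w \near z, (- M%:E <= u w)%E).
  apply: cK => z /h[M zM].
  exists ([set w | \forall w' \near w, (- M%:E <= u w')%E], [set M' | M <= M']).
    split => /=; first exact: nbhs_interior zM.
    by apply: nbhs_pinfty_ge; exact: num_real.
  move=> [w M'] /= [+ MM']; apply: filterS => x; apply: le_trans.
  by rewrite lee_fin lerN2.
suff [M [M0 hM]] : exists M, 0 <= M /\
    K `<=` (fun z => \forall w \near z, (- M%:E <= u w)%E).
  by exists M.
apply: (@filter_ex _ +oo%R); near=> M; split; last by near: M.
by near: M; apply: nbhs_pinfty_ge; exact: num_real.
Unshelve. all: end_near. Qed.

End poles.

(** * Gluing plurisubharmonic functions *)

Section gluing.
Variables (R : realType) (n : nat).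

(* [max v p] on [U], extended by [p]: the two agree near [D `\` U] because
   there [v <= 0 <= p]. *)
Lemma psh_glue (D U N : set (Cn R n)) (v p : Cn R n -> \bar R) :
  open D -> open U -> open N -> D `\` U `<=` N ->
  psh (U `&` D) v -> (forall z, (U `&` D) z -> (v z <= 0)%E) ->
  psh D p -> (forall z, N z -> (0 <= p z)%E) ->
  psh D (fun z => if z \in U then Order.max (v z) (p z) else p z).
Proof.
move=> oD oU oN DUN pv v0 pp p0; apply: psh_local => // z Dz.
have [Uz|nUz] := pselect (U z).
  exists (U `&` D); split => //; first exact: openI.
  apply: (@psh_ext _ _ _ (fun z => Order.max (v z) (p z))); first exact: openI.
    by move=> w [Uw _]; rewrite mem_set.
  by apply: psh_max => //; apply: psh_subset pp => w [].
(* Near a point outside [U] the glued function is simply [p], also at the nearby points of [U]. *)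
exists (N `&` D); split => //; [exact: openI|by split => //; exact: DUN|].
apply: (@psh_ext _ _ _ p); first exact: openI.
  move=> w [Nw Dw]; case: ifPn => // /set_mem Uw; rewrite max_r//.
  by apply: le_trans (p0 _ Nw); exact: v0.
by apply: psh_subset pp => w [].
Qed.

End gluing.

(** * Comparison of the two extremal functions *)

Theorem theorem3p6 (R : realType) (n : nat) (G E : set (Cn R n))
  (u : Cn R n -> \bar R) :
  domain G -> E `<=` G -> pluripolar E -> psh G u ->
  E `<=` [set z | G z /\ u z = -oo%E] ->
  locally_bounded_on (G `\` [set z | G z /\ u z = -oo%E]) u ->
  forall D U : set (Cn R n),
    domain D -> relcompact_in D G -> open U ->
    [set z | G z /\ u z = -oo%E] `<=` U ->
    forall z, (U `&` D) z ->
      rel_extremal (E `&` D) D z = rel_extremal (E `&` D) (U `&` D) z.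
Proof.
move=> [oG _] _ _ pu EZ lb D U [oD _] [cD DG] oU ZU z [Uz Dz].
have [uy us _] := pu.
have DcD := @subset_closure _ D.
have [C C0 uC] := usc_bounded us uy cD DG.
have [M M0 uM] : exists2 M : R, 0 <= M & forall k, (closure D `\` U) k ->
    \forall w \near k, (- M%:E <= u w)%E.
  apply: bounded_below_near_compact.
    apply: (subclosed_compact _ cD); last by move=> ? [].
    by apply: closedI; [exact: closed_closure|exact: open_closedC].
  move=> k [/DG Gk nUk].
  have uk : u k != -oo%E by apply/eqP => uk; apply: nUk; exact: ZU.
  (* Local boundedness controls [u] only off the poles; [psh_bounded_below_near] extends the lower
     bound to all points near [k]. *)
  have [|M kM] := lb k; first by split => // -[_ /eqP]; apply/negP.
  exists M; apply: (psh_bounded_below_near oG pu Gk uk).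
  apply: filterS2 kM (open_nbhs_nbhs (conj oG Gk)) => w h Gw uw.
  have : (`|u w| <= M%:E)%E.
    by apply: h; split => // -[_ /eqP]; apply/negP.
  by case: (u w) => [x| |]//=; rewrite !lee_fin ?ler_norml ?leey//; lra.
pose N : set (Cn R n) := [set w | (- M%:E <= u w)%E]°.
(* The first inequality restricts competitors from [D] to the smaller set; the second one extends
   them. *)
congr (- _)%E; apply/eqP; rewrite eq_le; apply/andP; split.
  apply: ereal_sup_le => _ [v [pv vE v0] <-]; exists v => //; split => //.
    by apply: psh_subset pv => w [].
  by move=> w [_ /v0].
apply: ge_ereal_sup => _ [v [pv vE v0] <-].
apply/lee_addgt0Pr => eta eta0.
(* The added [1] in the denominator covers the case [C = M = 0]. *)
have [e e0 eE] : exists2 e, 0 < e & e * (C + M) <= eta.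
  have CM : 0 < C + M + 1 by lra.
  exists (eta / (C + M + 1)); first exact: divr_gt0.
  by rewrite mulrAC ler_pdivrMr// ler_wpM2l//; [exact: ltW|lra].
pose p w := (e%:E * u w + (e * M)%:E)%E.
pose w x := if x \in U then Order.max (v x) (p x) else p x.
have pw : psh D w.
  apply: (@psh_glue _ _ D U N) => //.
  - exact: open_interior.
  - by move=> x [Dx nUx]; apply: uM; split => //; exact: DcD.
  - by apply: psh_affine => //; apply: psh_subset pu => x /DcD/DG.
  - move=> x /interior_subset /= h.
    have := @lee_wpmul2l _ e%:E _ _ _ h.
    rewrite lee_fin => /(_ (ltW e0)) h'; rewrite /p.
    apply: le_trans (leeD2r _ h').
    by rewrite -EFinM -EFinD lee_fin; lra.
have pC x : D x -> (p x <= (e * (C + M))%:E)%E.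
  move=> /DcD/uC h; rewrite /p mulrDr EFinD; apply: leeD2r; rewrite EFinM.
  by apply: lee_wpmul2l => //; rewrite lee_fin ltW.
have wC x : D x -> (w x <= (e * (C + M))%:E)%E.
  move=> Dx; rewrite /w; case: ifPn => [/set_mem Ux|_]; last exact: pC.
  rewrite ge_max pC// andbT (le_trans (v0 _ (conj Ux Dx)))// lee_fin.
  by rewrite mulr_ge0 ?addr_ge0// ltW.
apply: (@le_trans _ _ (w z)).
  by rewrite /w mem_set// le_max lexx.
(* The competitor on [D], written with a factor [1] to match [psh_affine]. *)
pose w' x := (1%:E * w x + (- (e * (C + M)))%:E)%E.
have w'E x : w' x = (w x - (e * (C + M))%:E)%E by rewrite /w' mul1e EFinN.
apply: (@le_trans _ _ (w' z + eta%:E)%E).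
  rewrite w'E -addeA -[leLHS]adde0; apply: leeD2l.
  by rewrite -EFinN -EFinD lee_fin; lra.
apply: leeD2r; apply: ereal_sup_ubound; exists w' => //; split.
- exact: psh_affine.
- move=> x [Ex Dx]; have [Gx ux] := EZ x Ex.
  have Ux : U x by exact: ZU.
  have wv : w x = v x.
    rewrite /w mem_set// /p ux mulrNy gtr0_sg// mul1e addNye max_l//.
    by rewrite leNye.
  rewrite w'E wv; apply: le_trans (vE x (conj Ex Dx)).
  by rewrite leeBlDr// leeDl// lee_fin mulr_ge0 ?addr_ge0// ltW.
- by move=> x Dx; rewrite w'E sube_le0 ?wC.
Qed.
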